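(* The system $\mathbf{IK}$ is a conservative extension of $\mathbf{MI_{\Box}}$: for every formula $\phi$ built from proposition letters, $\top$, $\wedge$, $\to$ and $\Box$, we have $\mathbf{IK}\vdash\phi$ if and only if $\mathbf{MI_{\Box}}\vdash\phi$.
   Context: $\mathbf{MI_{\Box}}$ is derived by modus ponens from substitution instances of $p\to(q\to p)$, $(p\to(q\to r))\to((p\to q)\to(p\to r))$, $(p\wedge q)\to p$, $(p\wedge q)\to q$, $p\to(q\to(p\wedge q))$, $\top$, $\Box(p\wedge q)\leftrightarrow(\Box p\wedge\Box q)$, $\Box\top\leftrightarrow\top$, closed under the rule from $p\leftrightarrow q$ infer $\Box p\leftrightarrow\Box q$. $\mathbf{IK}$ is the intuitionistic modal logic of Plotkin and Stirling (in the language of intuitionistic propositional logic with $\Box$ and $\Diamond$); it proves $\Box(p\wedge q)\leftrightarrow(\Box p\wedge\Box q)$ and $\Box\top\leftrightarrow\top$ and is sound with respect to intuitionistic modal frames: tuples $(X,\leq,R)$ with $(X,\leq)$ a poset and $R$ a relation satisfying $({\geq}\circ R)\subseteq(R\circ{\geq})$ and $(R\circ{\leq})\subseteq({\leq}\circ R)$ (where $x(R_1\circ R_2)z$ iff $\exists y$, $xR_1y$, $yR_2z$), with valuations assigning up-closed sets, intuitionistic connectives as in Kripke semantics, $x\Vdash\Diamond\phi$ iff some $y$ with $xRy$ satisfies $\phi$, and $x\Vdash\Box\phi$ iff every $y$ with $x({\leq}\circ R)y$ satisfies $\phi$. *)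

(* Defs.v *)
(* [V] is the set of proposition letters. Both axiomatisations are given by
   schemas ranging over all formulas, i.e. by all substitution instances of the
   axioms. *)

Inductive box_form (V : Type) : Type :=
| BVar (v : V)
| BTop
| BAnd (p q : box_form V)
| BImp (p q : box_form V)
| BBox (p : box_form V).

Arguments BVar {V} v.
Arguments BTop {V}.
Arguments BAnd {V} p q.
Arguments BImp {V} p q.
Arguments BBox {V} p.

Definition BIff {V : Type} (p q : box_form V) : box_form V :=
  BAnd (BImp p q) (BImp q p).

Inductive MI_box {V : Type} : box_form V -> Prop :=
| MI_K p q : MI_box (BImp p (BImp q p))
| MI_S p q r :
    MI_box (BImp (BImp p (BImp q r)) (BImp (BImp p q) (BImp p r)))
| MI_and_l p q : MI_box (BImp (BAnd p q) p)
| MI_and_r p q : MI_box (BImp (BAnd p q) q)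
| MI_and_i p q : MI_box (BImp p (BImp q (BAnd p q)))
| MI_top : MI_box BTop
| MI_box_and p q :
    MI_box (BIff (BBox (BAnd p q)) (BAnd (BBox p) (BBox q)))
| MI_box_top : MI_box (BIff (BBox BTop) BTop)
| MI_mp p q : MI_box (BImp p q) -> MI_box p -> MI_box q
| MI_box_congr p q :
    MI_box (BIff p q) -> MI_box (BIff (BBox p) (BBox q)).

Inductive form (V : Type) : Type :=
| Var (v : V)
| Top
| Bot
| And (p q : form V)
| Or (p q : form V)
| Imp (p q : form V)
| Box (p : form V)
| Dia (p : form V).

Arguments Var {V} v.
Arguments Top {V}.
Arguments Bot {V}.
Arguments And {V} p q.
Arguments Or {V} p q.
Arguments Imp {V} p q.
Arguments Box {V} p.
Arguments Dia {V} p.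

(* The Plotkin-Stirling axiomatisation: a Hilbert calculus for intuitionistic
   propositional logic (up to [IK_efq]), five modal axioms, modus ponens and
   necessitation. [Imp p Bot] is the negation of [p]. *)
Inductive IK {V : Type} : form V -> Prop :=
| IK_K p q : IK (Imp p (Imp q p))
| IK_S p q r : IK (Imp (Imp p (Imp q r)) (Imp (Imp p q) (Imp p r)))
| IK_and_l p q : IK (Imp (And p q) p)
| IK_and_r p q : IK (Imp (And p q) q)
| IK_and_i p q : IK (Imp p (Imp q (And p q)))
| IK_or_l p q : IK (Imp p (Or p q))
| IK_or_r p q : IK (Imp q (Or p q))
| IK_or_e p q r : IK (Imp (Imp p r) (Imp (Imp q r) (Imp (Or p q) r)))
| IK_top : IK Top
| IK_efq p : IK (Imp Bot p)
| IK_box_imp p q : IK (Imp (Box (Imp p q)) (Imp (Box p) (Box q)))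
| IK_dia_imp p q : IK (Imp (Box (Imp p q)) (Imp (Dia p) (Dia q)))
| IK_dia_bot : IK (Imp (Dia Bot) Bot)
| IK_dia_or p q : IK (Imp (Dia (Or p q)) (Or (Dia p) (Dia q)))
| IK_dia_box p q : IK (Imp (Imp (Dia p) (Box q)) (Box (Imp p q)))
| IK_mp p q : IK (Imp p q) -> IK p -> IK q
| IK_nec p : IK p -> IK (Box p).

Fixpoint embed {V : Type} (p : box_form V) : form V :=
  match p with
  | BVar v => Var v
  | BTop => Top
  | BAnd p q => And (embed p) (embed q)
  | BImp p q => Imp (embed p) (embed q)
  | BBox p => Box (embed p)
  end.

(* Main.v *)
Require Import Defs.

(** [IK] is sound for birelational frames, and [MI_box] is complete for one of
    them. Its worlds are all deductively closed sets of box formulas, the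
    inconsistent one included, ordered by inclusion, and [S] sees [T] when [T]
    contains every [p] with [Box p] in [S]. Since the language has neither
    disjunction nor [Bot], no primeness or consistency of worlds is required
    for the truth lemma. This is what makes [le_acc] hold: the world it asks for
    is the join of two theories, which need not be prime or consistent. *)

(** * Birelational semantics and soundness *)

(** Antisymmetry of the order is not used by soundness, which spares a quotient
    (or extensionality) on the canonical frame. *)
Record modal_frame := {
  world :> Type;
  le : world -> world -> Prop;
  acc : world -> world -> Prop;
  le_refl x : le x x;
  le_trans x y z : le x y -> le y z -> le x z;
  le_acc x y z : le x y -> acc x z -> exists w, acc y w /\ le z w;
  acc_le x y z : acc x y -> le y z -> exists w, le x w /\ acc w z
}.

Arguments le {m}.
Arguments acc {m}.

Fixpoint forces {V : Type} {X : modal_frame} (val : V -> X -> Prop)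
    (p : form V) (x : X) : Prop :=
  match p with
  | Var v => val v x
  | Top => True
  | Bot => False
  | And p q => forces val p x /\ forces val q x
  | Or p q => forces val p x \/ forces val q x
  | Imp p q => forall y, le x y -> forces val p y -> forces val q y
  | Box p => forall y z, le x y -> acc y z -> forces val p z
  | Dia p => exists y, acc x y /\ forces val p y
  end.

Definition persistent {V : Type} {X : modal_frame} (val : V -> X -> Prop) :=
  forall v x y, le x y -> val v x -> val v y.

(** The [Dia] case rests on [le_acc], which moves the witness to a larger world; [Imp] and [Box]
    already quantify over all larger worlds. *)
Lemma forces_le {V : Type} {X : modal_frame} (val : V -> X -> Prop) :
  persistent val -> forall p x y, le x y -> forces val p x -> forces val p y.
Proof.
  intros Hval p; induction p; simpl; intros x y Hxy Hx; eauto using le_trans.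
  - destruct Hx; split; eauto.
  - destruct Hx; eauto.
  - destruct Hx as [z [Hxz Hz]].
    destruct (le_acc _ _ _ _ Hxy Hxz) as [w [Hyw Hzw]]; eauto.
Qed.

Theorem IK_sound {V : Type} {X : modal_frame} (val : V -> X -> Prop) :
  persistent val -> forall p, IK p -> forall x, forces val p x.
Proof.
  intros Hval p Hp; pose proof (forces_le val Hval) as Hle.
  induction Hp; simpl in *; intros x.
  - eauto.
  - intros y _ Hpqr z Hyz Hpq w Hzw Hw.
    apply (Hpqr w); eauto using le_trans, le_refl.
  - tauto.
  - tauto.
  - eauto.
  - auto.
  - auto.
  - intros y _ Hpr z Hyz Hqr w Hzw [Hw | Hw]; eauto using le_trans.
  - exact I.
  - tauto.
  - intros y _ Hpq z Hyz Hp' w u Hzw Hwu.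
    apply (Hpq w u); eauto using le_trans, le_refl.
  - intros y _ Hpq z Hyz [w [Hzw Hw]].
    exists w; split; [exact Hzw|].
    apply (Hpq z w); eauto using le_refl.
  - intros y _ [z [_ []]].
  - intros y _ [z [Hyz [Hz | Hz]]]; eauto.
  - intros y _ Hpq z w Hyz Hzw u Hwu Hu.
    (* [acc_le] gives a world [z'] above [z] that sees [u]. As [u] forces [p], [z'] forces [Dia p],
       hence [Box q], and this puts [q] at [u]. *)
    destruct (acc_le _ _ _ _ Hzw Hwu) as [z' [Hzz' Hz'u]].
    apply (Hpq z') with (y := z'); eauto using le_trans, le_refl.
  - eauto using le_refl.
  - auto.
Qed.

(** * Deductively closed sets *)

Record is_theory {V : Type} (T : box_form V -> Prop) : Prop := {
  theory_thm p : MI_box p -> T p;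
  theory_mp p q : T (BImp p q) -> T p -> T q
}.

Arguments theory_thm {V T} _ {p}.
Arguments theory_mp {V T} _ {p q}.

Lemma is_theory_MI_box {V : Type} : is_theory (@MI_box V).
Proof. split; [auto | exact MI_mp]. Qed.

Section Theory.

Context {V : Type} {T : box_form V -> Prop} (HT : is_theory T).

Lemma theory_weaken p q : T q -> T (BImp p q).
Proof. apply (theory_mp HT), (theory_thm HT), MI_K. Qed.

Lemma theory_mp_under p q r :
  T (BImp p (BImp q r)) -> T (BImp p q) -> T (BImp p r).
Proof.
  intros Hpqr; apply (theory_mp HT); revert Hpqr.
  apply (theory_mp HT), (theory_thm HT), MI_S.
Qed.

Lemma theory_imp_trans p q r : T (BImp p q) -> T (BImp q r) -> T (BImp p r).
Proof. intros Hpq Hqr; eauto using theory_mp_under, theory_weaken. Qed.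

Lemma theory_imp_refl p : T (BImp p p).
Proof. apply theory_mp_under with (BImp p p); apply (theory_thm HT), MI_K. Qed.

Lemma theory_and p q : T (BAnd p q) <-> T p /\ T q.
Proof.
  split.
  - intros Hpq; split; revert Hpq; apply (theory_mp HT), (theory_thm HT);
      constructor.
  - intros [Hp Hq]; revert Hq; apply (theory_mp HT); revert Hp.
    apply (theory_mp HT), (theory_thm HT), MI_and_i.
Qed.

Lemma theory_imp_and p q r :
  T (BImp p q) -> T (BImp p r) -> T (BImp p (BAnd q r)).
Proof.
  intros Hq; apply theory_mp_under; apply (theory_imp_trans _ _ _ Hq).
  apply (theory_thm HT), MI_and_i.
Qed.

(** The theory generated by [T] and [p], described through the deduction theorem. *)
Lemma is_theory_extend p : is_theory (fun q => T (BImp p q)).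
Proof.
  split.
  - intros q Hq; apply theory_weaken, (theory_thm HT), Hq.
  - intros q r; apply theory_mp_under.
Qed.

End Theory.

(** The theory generated by the union of [S] and [T]. A single premise from [S] suffices because [S]
    is closed under conjunction. *)
Lemma is_theory_join {V : Type} (S T : box_form V -> Prop) :
  is_theory S -> is_theory T ->
  is_theory (fun q => exists p, S p /\ T (BImp p q)).
Proof.
  intros HS HT; split.
  - intros q Hq; exists BTop; split.
    + apply (theory_thm HS), MI_top.
    + apply (theory_weaken HT), (theory_thm HT), Hq.
  - intros q r [p [Hp Hpqr]] [p' [Hp' Hp'q]].
    exists (BAnd p p'); split; [apply (theory_and HS); auto|].
    apply (theory_mp_under HT) with q; eapply (theory_imp_trans HT); eauto;
      apply (theory_thm HT); constructor.
Qed.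

(** * Modal reasoning in [MI_box] *)

Lemma MI_box_iff {V : Type} (p q : box_form V) :
  MI_box (BIff p q) <-> MI_box (BImp p q) /\ MI_box (BImp q p).
Proof. apply (theory_and is_theory_MI_box). Qed.

(** If [p] implies [q], then [p] is equivalent to [BAnd p q]; congruence and distribution of the box
    over conjunction do the rest. *)
Lemma MI_box_mono {V : Type} (p q : box_form V) :
  MI_box (BImp p q) -> MI_box (BImp (BBox p) (BBox q)).
Proof.
  intros Hpq; pose proof (@is_theory_MI_box V) as HM.
  assert (Hiff : MI_box (BIff p (BAnd p q))).
  { apply MI_box_iff; split; [|constructor].
    apply (theory_imp_and HM); [apply (theory_imp_refl HM) | exact Hpq]. }
  apply MI_box_congr, MI_box_iff in Hiff.
  pose proof (proj1 (MI_box_iff _ _) (MI_box_and p q)) as [Hbox _].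
  eapply (theory_imp_trans HM); [apply Hiff|].
  eapply (theory_imp_trans HM); [apply Hbox|constructor].
Qed.

Lemma MI_box_nec {V : Type} (p : box_form V) : MI_box p -> MI_box (BBox p).
Proof.
  intros Hp; pose proof (@is_theory_MI_box V) as HM.
  apply MI_mp with (BBox BTop); [apply MI_box_mono, (theory_weaken HM), Hp|].
  apply MI_mp with BTop; [|apply MI_top].
  apply MI_box_iff, MI_box_top.
Qed.

(** This will be the least theory seen by [T]. Closure under modus ponens boxes the implication from
    [BAnd (BImp p q) p] to [q]. *)
Lemma is_theory_unbox {V : Type} (T : box_form V -> Prop) :
  is_theory T -> is_theory (fun p => T (BBox p)).
Proof.
  intros HT; pose proof (@is_theory_MI_box V) as HM; split.
  - intros p Hp; apply (theory_thm HT), MI_box_nec, Hp.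
  - intros p q Hpq Hp.
    apply (theory_mp HT (p := BBox (BAnd (BImp p q) p))).
    + apply (theory_thm HT), MI_box_mono.
      apply (theory_mp_under HM) with p; constructor.
    + apply (theory_mp HT (p := BAnd (BBox (BImp p q)) (BBox p))).
      * apply (theory_thm HT), MI_box_iff, MI_box_and.
      * apply (theory_and HT); auto.
Qed.

(** * The canonical frame and its truth lemma *)

Record theory (V : Type) := Theory {
  mem :> box_form V -> Prop;
  memP : is_theory mem
}.

Arguments Theory {V} mem memP.
Arguments mem {V}.
Arguments memP {V}.

Definition incl {V : Type} (S T : theory V) : Prop := forall p, S p -> T p.

Definition sees {V : Type} (S T : theory V) : Prop :=
  forall p, S (BBox p) -> T p.

Lemma incl_sees {V : Type} (S S' T : theory V) :
  incl S S' -> sees S T -> exists T', sees S' T' /\ incl T T'.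
Proof.
  intros _ _.
  (* The least theory that contains [T] and is seen by [S']. *)
  exists (Theory _ (is_theory_join _ _ (is_theory_unbox _ (memP S')) (memP T))).
  split; intros p Hp; simpl.
  - exists p; split; [exact Hp | apply (theory_imp_refl (memP T))].
  - exists BTop; split.
    + apply (theory_thm (is_theory_unbox _ (memP S'))), MI_top.
    + apply (theory_weaken (memP T)), Hp.
Qed.

Lemma sees_incl {V : Type} (S T T' : theory V) :
  sees S T -> incl T T' -> exists S', incl S S' /\ sees S' T'.
Proof. intros HST HTT'; exists S; split; intros p Hp; auto. Qed.

Definition canonical_frame (V : Type) : modal_frame := {|
  world := theory V;
  le := incl;
  acc := sees;
  le_refl := fun S p Hp => Hp;
  le_trans := fun S T U HST HTU p Hp => HTU p (HST p Hp);
  le_acc := incl_sees;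
  acc_le := sees_incl
|}.

Definition canonical_val {V : Type} (v : V) (T : canonical_frame V) : Prop :=
  mem T (BVar v).

Lemma truth {V : Type} (p : box_form V) (T : canonical_frame V) :
  forces canonical_val (embed p) T <-> mem T p.
Proof.
  revert T; induction p as [v | | p IHp q IHq | p IHp q IHq | p IHp];
    intros T; pose proof (memP T) as HT; simpl.
  - apply iff_refl.
  - split; [intros _; apply (theory_thm HT), MI_top | auto].
  - specialize (IHp T); specialize (IHq T).
    pose proof (theory_and HT p q); tauto.
  - split.
    + intros Hpq.
      (* Membership of [q] in [U] is by definition membership of [BImp p q] in [T]. *)
      set (U := Theory _ (is_theory_extend HT p) : canonical_frame V).
      apply (IHq U), Hpq.
      * intros r; apply (theory_weaken HT).
      * apply IHp, (theory_imp_refl HT).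
    + intros Hpq U HTU Hp; apply IHq; apply IHp in Hp.
      exact (theory_mp (memP U) (HTU _ Hpq) Hp).
  - split.
    + intros Hp.
      (* [T] sees [U], and [p] in [U] means [BBox p] in [T]. *)
      set (U := Theory _ (is_theory_unbox _ HT) : canonical_frame V).
      apply (IHp U), (Hp T); intros r Hr; exact Hr.
    + intros Hp U W HTU HUW; apply IHp, HUW, HTU, Hp.
Qed.

(** * Derivation of the [MI_box] axioms and rules in [IK] *)

Lemma IK_imp_trans {V : Type} (p q r : form V) :
  IK (Imp p q) -> IK (Imp q r) -> IK (Imp p r).
Proof. eauto using IK_mp, IK_K, IK_S. Qed.

Lemma IK_imp_and {V : Type} (p q r : form V) :
  IK (Imp p q) -> IK (Imp p r) -> IK (Imp p (And q r)).
Proof.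
  intros Hq; apply IK_mp; eapply IK_mp; [apply IK_S|].
  apply (IK_imp_trans _ _ _ Hq), IK_and_i.
Qed.

Lemma IK_and_intro {V : Type} (p q : form V) : IK p -> IK q -> IK (And p q).
Proof. eauto using IK_mp, IK_and_i. Qed.

Lemma IK_box_mono {V : Type} (p q : form V) :
  IK (Imp p q) -> IK (Imp (Box p) (Box q)).
Proof. eauto using IK_mp, IK_nec, IK_box_imp. Qed.

Lemma IK_box_and {V : Type} (p q : form V) :
  IK (Imp (And (Box p) (Box q)) (Box (And p q))).
Proof.
  apply IK_mp with (Imp (And (Box p) (Box q)) (Box q)); [|apply IK_and_r].
  eapply IK_mp; [apply IK_S|].
  apply IK_imp_trans with (Box p); [apply IK_and_l|].
  (* Boxing the curried pairing axiom reduces the goal to the K axiom. *)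
  apply IK_imp_trans with (Box (Imp q (And p q))).
  - apply IK_box_mono, IK_and_i.
  - apply IK_box_imp.
Qed.

Lemma IK_embed {V : Type} (p : box_form V) : MI_box p -> IK (embed p).
Proof.
  intros Hp; induction Hp; simpl in *; try (constructor; fail).
  - apply IK_and_intro; [|apply IK_box_and].
    apply IK_imp_and; apply IK_box_mono; constructor.
  - apply IK_and_intro; (eapply IK_mp; [apply IK_K|]);
      auto using @IK_top, @IK_nec.
  - eauto using IK_mp.
  - apply IK_and_intro; apply IK_box_mono;
      (eapply IK_mp; [|exact IHHp]); constructor.
Qed.

Theorem theorem6p4 :
  forall (V : Type) (phi : box_form V), IK (embed phi) <-> MI_box phi.
Proof.
  intros V phi; split; [|apply IK_embed].
  intros Hphi.
  (* At the world of all theorems, being forced means being provable. *)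
  pose (L := Theory _ is_theory_MI_box : canonical_frame V).
  apply (truth phi L), IK_sound; [|exact Hphi].
  intros v S T HST; apply HST.
Qed.
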